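(* Every plain dependent type theory $(\mathbf{ctx},u,\dot u,\Sigma\dashv\Delta)$ contains the rules of type and term dependency: (DTy) from $\Gamma\vdash a:A$ and $\Gamma.A\vdash B$ type, deduce $\Gamma\vdash B[a]$ type; (DTm) from $\Gamma\vdash a:A$ and $\Gamma.A\vdash b:B$, deduce $\Gamma\vdash b[a]:B[a]$. In detail, let $\eta'=\dot u\ast\eta:\dot u\Rightarrow\dot u\Delta\Sigma$ be the whiskering of the unit $\eta$ of $\Sigma\dashv\Delta$. The $\sharp$-liftings of $\eta'$ along $u$ and along $\dot u$ give functors in the theory $$u^*\mathrm{id}:\dot{\mathcal U}.\Sigma\Delta\mathcal U\to\dot{\mathcal U}\times_{\mathbf{ctx}}\mathcal U,\quad (a,B)\mapsto(a,B[a]),\qquad \dot u^*\mathrm{id}:\dot{\mathcal U}.\Sigma\Delta\dot{\mathcal U}\to\dot{\mathcal U}\times_{\mathbf{ctx}}\dot{\mathcal U},\quad (a,b)\mapsto(a,b[a]),$$ and policies $u^*\eta'$, $\dot u^*\eta'$ in the theory whose components are the cartesian lifts $B[a]\to B$ and $b[a]\to b$ of $\eta'_a:\Gamma\to\Gamma.A$, where $\Gamma=\dot u(a)$, $A=\Sigma a$, $\Gamma.A=\dot u\Delta A$. The typing is the appropriate one: if $\Sigma b=B$ then $\Sigma(b[a])=B[a]$. Moreover the premise can be re-based over $\Gamma$: let $v:\mathcal U.\Delta\mathcal U\to\mathbf{ctx}$ be $(A,B)\mapsto u(A)$. Pasting $u^*\eta'$ with the policy $\delta=u\ast\epsilon:\dot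 u\Delta\Rightarrow u$ gives a policy, from the composite of $u^*\mathrm{id}$ with the projection $\dot{\mathcal U}\times_{\mathbf{ctx}}\mathcal U\to\mathbf{ctx}$ to the composite $\dot{\mathcal U}.\Sigma\Delta\mathcal U\to\mathcal U.\Delta\mathcal U\xrightarrow{v}\mathbf{ctx}$, where the first functor is $(a,B)\mapsto(\Sigma a,B)$; this policy is (DTy), with both premise $(a,B)$ and conclusion lying over $\Gamma$. A similar argument for terms gives (DTm).
   Context: Plain dependent type theory: a category $\mathbf{ctx}$ (with terminal object), fibrations (with given cleavages) $u:\mathcal U\to\mathbf{ctx}$ (types) and $\dot u:\dot{\mathcal U}\to\mathbf{ctx}$ (terms), a functor $\Sigma:\dot{\mathcal U}\to\mathcal U$ (typing) with $u\Sigma=\dot u$, and a right adjoint $\Delta:\mathcal U\to\dot{\mathcal U}$ of $\Sigma$ (not required to commute with the functors to $\mathbf{ctx}$), with unit $\eta$ and counit $\epsilon$, such that $\Sigma$ and $\Delta$ preserve cartesian morphisms and the components of $\eta$ and $\epsilon$ are cartesian; formally it is the judgemental theory generated by these data. Notation for judgements: ''$\Gamma\vdash A$ type'' means $A\in\mathcal U$ with $u(A)=\Gamma$; ''$\Gamma\vdash a:A$'' means $a\in\dot{\mathcal U}$ with $\dot u(a)=\Gamma$ and $\Sigma a=A$ (equality of objects of $\mathcal U$). $\mathcal U.\Delta\mathcal U$ is the pullback of $\dot u\Delta:\mathcal U\to\mathbf{ctx}$ and $u$ (objects: pairs $(A,B)$ with $u(B)=\dot u\Delta A$). $\dot{\mathcal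 U}.\Sigma\Delta\mathcal U$ is the pullback of $\dot u\Delta\Sigma:\dot{\mathcal U}\to\mathbf{ctx}$ and $u$ (objects: pairs $(a,B)$ with $u(B)=\dot u\Delta\Sigma a$). $\dot{\mathcal U}.\Sigma\Delta\dot{\mathcal U}$ is the pullback of $\dot u\Delta\Sigma$ and $\dot u$ (objects: pairs $(a,b)$ with $\dot u(b)=\dot u\Delta\Sigma a$). Judgemental theory: a category $\mathbf{ctx}$ with terminal object, a set $\mathscr R$ of functors (''rules''), of which those with codomain $\mathbf{ctx}$ are the ''judgement classifiers'', and a set $\mathscr P$ of natural transformations (''policies'') filling triangles of rules, such that $\mathscr R,\mathscr P$ are closed under composition, finite limits (pullbacks, equalizers, finite powers, with projections and functors induced by cones of rules), whiskering and $\sharp$-liftings. $\sharp$-lifting: given rules $\lambda:\mathcal F\to\mathcal G$, $r:\mathcal F\to\mathcal X$, $r':\mathcal G\to\mathcal X$, a policy $\lambda^\sharp:r'\lambda\Rightarrow r$ and a rule $h:\mathcal H\to\mathcal X$ which is a fibration, the $\sharp$-lifting of $\lambda^\sharp$ along $h$ consists of the functor $h^*\lambda:\mathcal F\times_{\mathcal X}\mathcal H\to\mathcal G\times_{\mathcal X}\mathcal H$, $(F,H)\mapsto(\lambda F,H[\lambda^\sharp_F])$ (reindexing along $\lambda^\sharp_F$), and the natural transformation $h^*\lambda^\sharp$ whose components are the cartesian lifts $H[\lambda^\sharp_F]\to H$; both are required to be in the theory (and dually for opfibrations). Here $\lambda=\mathrm{id}_{\dot{\mathcal U}}$, $r=\dot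 u\Delta\Sigma$, $r'=\dot u$, $\lambda^\sharp=\eta'$. The theory generated by given functors and natural transformations is the smallest one containing them.
   Formalization: Strict equality Σ(b[a]) = B[a] fails for unrelated cleavages of u and u̇; it is proved when Σ sends chosen lifts to chosen lifts, and in general Σ(b[a]) → B is shown to be a cartesian lift, with a unique compatible vertical isomorphism Σ(b[a]) ≅ B[a]. *)

(* Defs.v *)
From Stdlib Require Import FunctionalExtensionality ProofIrrelevance.
From mathcomp Require Import all_boot.

Set Implicit Arguments.
Unset Strict Implicit.
Unset Printing Implicit Defensive.

(* Categories are presented by a type of objects and a single type of arrows
   with source and target, composition being defined on composable pairs.
   Equality of objects, arrows and functors is strict; with this presentation
   an equality of functors never forces arrows to be transported. *)

Record category := Category {
  ob : Type;
  mor : Type;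
  src : mor -> ob;
  tgt : mor -> ob;
  idm : ob -> mor;
  mcomp : forall g f : mor, src g = tgt f -> mor;
  src_idm : forall x, src (idm x) = x;
  tgt_idm : forall x, tgt (idm x) = x;
  src_mcomp : forall g f (e : src g = tgt f), src (mcomp e) = src f;
  tgt_mcomp : forall g f (e : src g = tgt f), tgt (mcomp e) = tgt g;
  mcomp_idl : forall f (e : src (idm (tgt f)) = tgt f), mcomp e = f;
  mcomp_idr : forall f (e : src f = tgt (idm (src f))), mcomp e = f;
  mcompA : forall h g f (e1 : src h = tgt g) (e2 : src g = tgt f)
             (e3 : src h = tgt (mcomp e2)) (e4 : src (mcomp e1) = tgt f),
      mcomp e3 = mcomp e4
}.

Arguments src {c}.
Arguments tgt {c}.
Arguments idm {c}.
Arguments mcomp {c}.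

(* [composite g f h]: g and f are composable and g after f equals h. *)
Definition composite (C : category) (g f h : mor C) : Prop :=
  exists e : src g = tgt f, mcomp g f e = h.

Definition arrow (C : category) (f : mor C) (x y : ob C) : Prop :=
  src f = x /\ tgt f = y.

Definition isomorphism (C : category) (f : mor C) : Prop :=
  exists g, composite g f (idm (src f)) /\ composite f g (idm (tgt f)).

Definition terminal (C : category) (t : ob C) : Prop :=
  forall x, exists! f : mor C, arrow f x t.

Record functor (C D : category) := Functor {
  fob :> ob C -> ob D;
  fmor : mor C -> mor D;
  src_fmor : forall f, src (fmor f) = fob (src f);
  tgt_fmor : forall f, tgt (fmor f) = fob (tgt f);
  fmor_id : forall x, fmor (idm x) = idm (fob x);
  fmor_comp : forall g f h, composite g f h ->
      composite (fmor g) (fmor f) (fmor h)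
}.

Definition fid (C : category) : functor C C.
Proof. by exists id id. Defined.

Definition fcomp (C D E : category) (G : functor D E) (F : functor C D) :
  functor C E.
Proof.
exists (G \o F) (fmor G \o fmor F) => /= [f|f|x|g f h gfh].
- by rewrite !src_fmor.
- by rewrite !tgt_fmor.
- by rewrite !fmor_id.
- exact/fmor_comp/fmor_comp.
Defined.

Notation "G \oc F" := (fcomp G F) (at level 40, left associativity).

Lemma functor_eq (C D : category) (F G : functor C D) :
  (forall x, F x = G x) -> (forall f, fmor F f = fmor G f) -> F = G.
Proof.
case: F G => [F0 F1 F2 F3 F4 F5] [G0 G1 G2 G3 G4 G5] /= E0 E1.
have E0' : F0 = G0 by apply: functional_extensionality.
have E1' : F1 = G1 by apply: functional_extensionality.
by subst; f_equal; apply: proof_irrelevance.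
Qed.

Record nattrans (C D : category) (F G : functor C D) := NatTrans {
  app :> ob C -> mor D;
  src_app : forall x, src (app x) = F x;
  tgt_app : forall x, tgt (app x) = G x;
  app_natural : forall f, exists h,
      composite (app (tgt f)) (fmor F f) h /\
      composite (fmor G f) (app (src f)) h
}.

Lemma mcomp_congr (C : category) (g f g' f' : mor C) e e' :
  g = g' -> f = f' -> mcomp g f e = mcomp g' f' e'.
Proof. by move=> E1 E2; subst; f_equal; apply: proof_irrelevance. Qed.

Lemma compositeE (C : category) (g f : mor C) :
  src g = tgt f -> exists h, composite g f h.
Proof. by move=> e; exists (mcomp g f e), e. Qed.

Lemma composite_id_l (C : category) (f : mor C) : composite (idm (tgt f)) f f.
Proof. by exists (src_idm (tgt f)); apply: mcomp_idl. Qed.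

Lemma composite_id_r (C : category) (f : mor C) : composite f (idm (src f)) f.
Proof. by exists (esym (tgt_idm (src f))); apply: mcomp_idr. Qed.

Lemma composite_src (C : category) (g f h : mor C) :
  composite g f h -> src h = src f.
Proof. by case=> e <-; rewrite src_mcomp. Qed.

Lemma composite_tgt (C : category) (g f h : mor C) :
  composite g f h -> tgt h = tgt g.
Proof. by case=> e <-; rewrite tgt_mcomp. Qed.

Lemma composite_assoc (C : category) (h g f hg gf k : mor C) :
  composite h g hg -> composite g f gf ->
  (composite hg f k <-> composite h gf k).
Proof.
move=> [e1 E1] [e2 E2]; subst hg gf; split=> -[e <-].
- have e' : src h = tgt (mcomp g f e2) by rewrite tgt_mcomp.
  by exists e'; apply: mcompA.
- have e' : src (mcomp h g e1) = tgt f by rewrite src_mcomp.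
  by exists e'; symmetry; apply: mcompA.
Qed.

Definition nid (C D : category) (F : functor C D) : nattrans F F.
Proof.
exists (fun x => idm (F x)) => [x|x|f]; rewrite ?src_idm ?tgt_idm //.
exists (fmor F f); rewrite -{1}tgt_fmor -src_fmor.
by split; [apply: composite_id_l | apply: composite_id_r].
Defined.

Lemma vcomp_compat (C D : category) (F G H : functor C D)
  (b : nattrans G H) (a : nattrans F G) x : src (b x) = tgt (a x).
Proof. by rewrite src_app tgt_app. Qed.

(* Vertical composite: first [a], then [b]. *)
Definition vcomp (C D : category) (F G H : functor C D)
  (b : nattrans G H) (a : nattrans F G) : nattrans F H.
Proof.
exists (fun x => mcomp (b x) (a x) (vcomp_compat b a x)) => [x|x|f].
- by rewrite src_mcomp src_app.
- by rewrite tgt_mcomp tgt_app.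
have [h1 [p1 p2]] := app_natural a f; have [h2 [q1 q2]] := app_natural b f.
have ba x : composite (b x) (a x) (mcomp (b x) (a x) (vcomp_compat b a x)).
  by exists (vcomp_compat b a x).
have [h ph] : exists h, composite (b (tgt f)) h1 h.
  by apply: compositeE; rewrite (composite_tgt p1) (vcomp_compat b a).
exists h; split; first exact/(composite_assoc _ (ba _) p1).
exact/(composite_assoc _ q2 (ba _))/(composite_assoc _ q1 p2).
Defined.

Definition whiskerl (C D E : category) (H : functor D E) (F G : functor C D)
  (a : nattrans F G) : nattrans (H \oc F) (H \oc G).
Proof.
exists (fun x => fmor H (a x)) => [x|x|f] /=.
- by rewrite src_fmor src_app.
- by rewrite tgt_fmor tgt_app.
have [h [p q]] := app_natural a f.
by exists (fmor H h); split; apply: fmor_comp.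
Defined.

Definition whiskerr (B C D : category) (F G : functor C D)
  (a : nattrans F G) (H : functor B C) : nattrans (F \oc H) (G \oc H).
Proof.
exists (fun x => a (H x)) => [x|x|f] /=.
- by rewrite src_app.
- by rewrite tgt_app.
by rewrite -tgt_fmor -src_fmor; apply: app_natural.
Defined.

Definition nt_cast (C D : category) (F F' G G' : functor C D)
  (eF : F = F') (eG : G = G') (a : nattrans F G) : nattrans F' G' :=
  match eF in _ = F1, eG in _ = G1 return nattrans F1 G1 with
  | erefl, erefl => a
  end.

Lemma sval_inj (T : Type) (P : T -> Prop) (x y : sig P) :
  sval x = sval y -> x = y.
Proof.
by case: x y => [x px] [y py] /= E; subst; f_equal; apply: proof_irrelevance.
Qed.

Lemma cone_ob (T A B X : category) (F : functor A X) (G : functor B X)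
  (S1 : functor T A) (S2 : functor T B) :
  F \oc S1 = G \oc S2 -> forall x, F (S1 x) = G (S2 x).
Proof. by move=> e x; apply: (congr1 (fun H : functor T X => H x) e). Qed.

Lemma cone_mor (T A B X : category) (F : functor A X) (G : functor B X)
  (S1 : functor T A) (S2 : functor T B) :
  F \oc S1 = G \oc S2 ->
  forall f, fmor F (fmor S1 f) = fmor G (fmor S2 f).
Proof. by move=> e f; apply: (congr1 (fun H : functor T X => fmor H f) e). Qed.

Section Pullback.
Variables (A B X : category) (F : functor A X) (G : functor B X).

Definition pb_ob : Type := {x : ob A * ob B | F x.1 = G x.2}.
Definition pb_mor : Type := {f : mor A * mor B | fmor F f.1 = fmor G f.2}.

Definition pb_src (f : pb_mor) : pb_ob.
Proof.
exists (src (sval f).1, src (sval f).2).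
by rewrite /= -!src_fmor (svalP f).
Defined.

Definition pb_tgt (f : pb_mor) : pb_ob.
Proof.
exists (tgt (sval f).1, tgt (sval f).2).
by rewrite /= -!tgt_fmor (svalP f).
Defined.

Definition pb_id (x : pb_ob) : pb_mor.
Proof.
exists (idm (sval x).1, idm (sval x).2).
by rewrite /= !fmor_id (svalP x).
Defined.

Lemma pb_e1 (g f : pb_mor) : pb_src g = pb_tgt f ->
  src (sval g).1 = tgt (sval f).1.
Proof. by move/(congr1 (fun z => (sval z).1)). Qed.

Lemma pb_e2 (g f : pb_mor) : pb_src g = pb_tgt f ->
  src (sval g).2 = tgt (sval f).2.
Proof. by move/(congr1 (fun z => (sval z).2)). Qed.

Definition pb_comp (g f : pb_mor) (e : pb_src g = pb_tgt f) : pb_mor.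
Proof.
exists (mcomp _ _ (pb_e1 e), mcomp _ _ (pb_e2 e)) => /=.
have [e1 <-] : composite (fmor F (sval g).1) (fmor F (sval f).1)
    (fmor F (mcomp _ _ (pb_e1 e))) by apply: fmor_comp; exists (pb_e1 e).
have [e2 <-] : composite (fmor G (sval g).2) (fmor G (sval f).2)
    (fmor G (mcomp _ _ (pb_e2 e))) by apply: fmor_comp; exists (pb_e2 e).
by apply: mcomp_congr; [exact: (svalP g) | exact: (svalP f)].
Defined.

Definition pullback : category.
Proof.
exists pb_ob pb_mor pb_src pb_tgt pb_id pb_comp.
- by move=> x; apply: sval_inj; rewrite /= !src_idm; case: (sval x).
- by move=> x; apply: sval_inj; rewrite /= !tgt_idm; case: (sval x).
- by move=> g f e; apply: sval_inj; rewrite /= !src_mcomp.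
- by move=> g f e; apply: sval_inj; rewrite /= !tgt_mcomp.
- by move=> f e; apply: sval_inj; rewrite /= !mcomp_idl; case: (sval f).
- by move=> f e; apply: sval_inj; rewrite /= !mcomp_idr; case: (sval f).
- by move=> h g f e1 e2 e3 e4; apply: sval_inj; congr pair; apply: mcompA.
Defined.

Definition pb1 : functor pullback A.
Proof.
exists (fun x : ob pullback => (sval x).1)
       (fun f : mor pullback => (sval f).1) => //.
by move=> g f h [e <-]; exists (pb_e1 e).
Defined.

Definition pb2 : functor pullback B.
Proof.
exists (fun x : ob pullback => (sval x).2)
       (fun f : mor pullback => (sval f).2) => //.
by move=> g f h [e <-]; exists (pb_e2 e).
Defined.

Definition pb_pair (T : category) (S1 : functor T A) (S2 : functor T B)
  (e : F \oc S1 = G \oc S2) : functor T pullback.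
Proof.
exists (fun x => exist _ (S1 x, S2 x) (cone_ob e x) : ob pullback)
       (fun f => exist _ (fmor S1 f, fmor S2 f) (cone_mor e f) : mor pullback).
- by move=> f; apply: sval_inj; rewrite /= !src_fmor.
- by move=> f; apply: sval_inj; rewrite /= !tgt_fmor.
- by move=> x; apply: sval_inj; rewrite /= !fmor_id.
move=> g f h gfh.
have [p1 E1] := fmor_comp S1 gfh; have [p2 E2] := fmor_comp S2 gfh.
unshelve eexists; first by apply: sval_inj; rewrite /= p1 p2.
apply: sval_inj => /=; congr pair.
- by rewrite -E1; apply: mcomp_congr.
- by rewrite -E2; apply: mcomp_congr.
Defined.

End Pullback.

Definition mkpb (A B X : category) (F : functor A X) (G : functor B X)
  (a : ob A) (b : ob B) (e : F a = G b) : ob (pullback F G) :=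
  exist (fun x : ob A * ob B => F x.1 = G x.2) (a, b) e.

Section Equalizer.
Variables (A B : category) (F G : functor A B).

Definition eq_ob : Type := {x : ob A | F x = G x}.
Definition eq_mor : Type := {f : mor A | fmor F f = fmor G f}.

Definition eq_src (f : eq_mor) : eq_ob.
Proof. by exists (src (sval f)); rewrite -!src_fmor (svalP f). Defined.

Definition eq_tgt (f : eq_mor) : eq_ob.
Proof. by exists (tgt (sval f)); rewrite -!tgt_fmor (svalP f). Defined.

Definition eq_id (x : eq_ob) : eq_mor.
Proof. by exists (idm (sval x)); rewrite !fmor_id (svalP x). Defined.

Lemma eq_e (g f : eq_mor) : eq_src g = eq_tgt f ->
  src (sval g) = tgt (sval f).
Proof. by move/(congr1 sval). Qed.

Definition eq_comp (g f : eq_mor) (e : eq_src g = eq_tgt f) : eq_mor.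
Proof.
exists (mcomp _ _ (eq_e e)).
have c : composite (sval g) (sval f) (mcomp _ _ (eq_e e)) by exists (eq_e e).
have [e1 <-] := fmor_comp F c; have [e2 <-] := fmor_comp G c.
by apply: mcomp_congr; [exact: (svalP g) | exact: (svalP f)].
Defined.

Definition equalizer : category.
Proof.
exists eq_ob eq_mor eq_src eq_tgt eq_id eq_comp.
- by move=> x; apply: sval_inj; rewrite /= src_idm.
- by move=> x; apply: sval_inj; rewrite /= tgt_idm.
- by move=> g f e; apply: sval_inj; rewrite /= src_mcomp.
- by move=> g f e; apply: sval_inj; rewrite /= tgt_mcomp.
- by move=> f e; apply: sval_inj; rewrite /= mcomp_idl.
- by move=> f e; apply: sval_inj; rewrite /= mcomp_idr.
- by move=> h g f e1 e2 e3 e4; apply: sval_inj; apply: mcompA.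
Defined.

Definition eq_incl : functor equalizer A.
Proof.
exists (fun x : ob equalizer => sval x)
       (fun f : mor equalizer => sval f) => //.
by move=> g f h [e <-]; exists (eq_e e).
Defined.

Definition eq_induced (T : category) (S : functor T A)
  (e : F \oc S = G \oc S) : functor T equalizer.
Proof.
exists (fun x => exist _ (S x) (cone_ob e x) : ob equalizer)
       (fun f => exist _ (fmor S f) (cone_mor e f) : mor equalizer).
- by move=> f; apply: sval_inj; rewrite /= src_fmor.
- by move=> f; apply: sval_inj; rewrite /= tgt_fmor.
- by move=> x; apply: sval_inj; rewrite /= fmor_id.
move=> g f h gfh; have [p E] := fmor_comp S gfh.
unshelve eexists; first exact: sval_inj.
by apply: sval_inj; rewrite /= -E; apply: mcomp_congr.
Defined.

End Equalizer.

Section Power.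
Variables (n : nat) (C : category).

Definition power : category.
Proof.
exists ('I_n -> ob C) ('I_n -> mor C) (fun f i => src (f i))
  (fun f i => tgt (f i)) (fun x i => idm (x i))
  (fun g f e i => mcomp (g i) (f i) (equal_f e i));
  move=> *; apply: functional_extensionality => i.
- exact: src_idm.
- exact: tgt_idm.
- exact: src_mcomp.
- exact: tgt_mcomp.
- exact: mcomp_idl.
- exact: mcomp_idr.
- exact: mcompA.
Defined.

Definition pow_proj (i : 'I_n) : functor power C.
Proof.
exists (fun x : ob power => x i) (fun f : mor power => f i) => //.
by move=> g f h [e <-]; exists (equal_f e i).
Defined.

Definition pow_tuple (T : category) (S : 'I_n -> functor T C) :
  functor T power.
Proof.
exists (fun x => (fun i => S i x) : ob power)
       (fun f => (fun i => fmor (S i) f) : mor power).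
- by move=> f; apply: functional_extensionality => i; apply: src_fmor.
- by move=> f; apply: functional_extensionality => i; apply: tgt_fmor.
- by move=> x; apply: functional_extensionality => i; apply: fmor_id.
move=> g f h gfh.
have c i := fmor_comp (S i) gfh.
unshelve eexists.
  by apply: functional_extensionality => i; case: (c i).
apply: functional_extensionality => i /=; case: (c i) => e <-.
exact: mcomp_congr.
Defined.

End Power.

Section Fibration.
Variables (H X : category) (p : functor H X).

Definition cartesian (f : mor H) : Prop :=
  forall (g : mor H) (w : mor X),
    tgt g = tgt f -> composite (fmor p f) w (fmor p g) ->
    exists! k : mor H, fmor p k = w /\ composite f k g.

Definition opcartesian (f : mor H) : Prop :=
  forall (g : mor H) (w : mor X),
    src g = src f -> composite w (fmor p f) (fmor p g) ->
    exists! k : mor H, fmor p k = w /\ composite k f g.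

Definition cartesian_lift (f : mor X) (y : ob H) (k : mor H) : Prop :=
  [/\ fmor p k = f, tgt k = y & cartesian k].

Definition opcartesian_lift (f : mor X) (x : ob H) (k : mor H) : Prop :=
  [/\ fmor p k = f, src k = x & opcartesian k].

Definition fibration : Prop :=
  forall (f : mor X) (y : ob H), tgt f = p y -> exists k, cartesian_lift f y k.

Definition opfibration : Prop :=
  forall (f : mor X) (x : ob H), src f = p x -> exists k, opcartesian_lift f x k.

Record cleavage := Cleavage {
  lift : forall (f : mor X) (y : ob H), tgt f = p y -> mor H;
  liftP : forall f y (e : tgt f = p y), cartesian_lift f y (lift e)
}.

Record opcleavage := Opcleavage {
  oplift : forall (f : mor X) (x : ob H), src f = p x -> mor H;
  opliftP : forall f x (e : src f = p x), opcartesian_lift f x (oplift e)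
}.

(* [reindex c e] is y[f], the domain of the chosen lift of f at y. *)
Definition reindex (c : cleavage) f y (e : tgt f = p y) : ob H :=
  src (lift c e).

End Fibration.

(* The convention that (op)fibrations come with given cleavages: a class of
   (op)cleavages containing at least one for every (op)fibration.  It is a
   relation rather than a function so that two cloven fibrations may share
   their underlying functor. *)
Record cleaving := Cleaving {
  given : forall H X (h : functor H X), cleavage h -> Prop;
  opgiven : forall H X (h : functor H X), opcleavage h -> Prop;
  given_total : forall H X (h : functor H X),
      fibration h -> exists c : cleavage h, given c;
  opgiven_total : forall H X (h : functor H X),
      opfibration h -> exists c : opcleavage h, opgiven c
}.

Section Sharp.
Variables (F G X H : category) (l : functor F G).
Variables (r : functor F X) (r' : functor G X) (h : functor H X).

Lemma sharp_compat (ls : nattrans (r' \oc l) r) (x : ob (pullback r h)) :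
  tgt (ls (pb1 r h x)) = h (pb2 r h x).
Proof. by rewrite tgt_app; apply: (svalP x). Qed.

Lemma opsharp_compat (ls : nattrans r (r' \oc l)) (x : ob (pullback r h)) :
  src (ls (pb1 r h x)) = h (pb2 r h x).
Proof. by rewrite src_app; apply: (svalP x). Qed.

(* [L] and [nu] are the functor and the natural transformation of the sharp
   lifting: [L] lies over [l], and the components of [nu], from the second
   coordinate of [L x] to that of [x], are the chosen cartesian lifts.  This
   forces L (a, y) = (l a, y[ls a]), and determines [L] on arrows because the
   components of [nu] are cartesian. *)
Definition sharp_lifting (c : cleavage h) (ls : nattrans (r' \oc l) r)
  (L : functor (pullback r h) (pullback r' h))
  (nu : nattrans (pb2 r' h \oc L) (pb2 r h)) : Prop :=
  pb1 r' h \oc L = l \oc pb1 r h /\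
  forall x, nu x = lift c (sharp_compat ls x).

Definition opsharp_lifting (c : opcleavage h) (ls : nattrans r (r' \oc l))
  (L : functor (pullback r h) (pullback r' h))
  (nu : nattrans (pb2 r h) (pb2 r' h \oc L)) : Prop :=
  pb1 r' h \oc L = l \oc pb1 r h /\
  forall x, nu x = oplift c (opsharp_compat ls x).

End Sharp.

Arguments sharp_lifting {F G X H l r r' h} c ls L nu.
Arguments opsharp_lifting {F G X H l r r' h} c ls L nu.

(* A policy filling a triangle r' l => r of rules is a natural transformation
   between the parallel rules r' l and r.  A category belongs to the theory
   when its identity functor is a rule. *)
Record judgemental_theory (K : cleaving) (ctx : category) := JudgementalTheory {
  rule : forall C D, functor C D -> Prop;
  policy : forall C D (F G : functor C D), nattrans F G -> Prop;
  ctx_terminal : exists t : ob ctx, terminal t;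
  policy_rule : forall C D (F G : functor C D) (a : nattrans F G),
      policy a -> rule F /\ rule G;
  rule_id : forall C D (F : functor C D),
      rule F -> rule (fid C) /\ rule (fid D);
  rule_comp : forall C D E (G : functor D E) (F : functor C D),
      rule G -> rule F -> rule (G \oc F);
  policy_id : forall C D (F : functor C D), rule F -> policy (nid F);
  policy_vcomp : forall C D (F G H : functor C D)
      (b : nattrans G H) (a : nattrans F G),
      policy b -> policy a -> policy (vcomp b a);
  policy_whiskerl : forall C D E (H : functor D E) (F G : functor C D)
      (a : nattrans F G), rule H -> policy a -> policy (whiskerl H a);
  policy_whiskerr : forall B C D (F G : functor C D) (a : nattrans F G)
      (H : functor B C), policy a -> rule H -> policy (whiskerr a H);
  rule_pullback : forall A B X (F : functor A X) (G : functor B X),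
      rule F -> rule G -> rule (pb1 F G) /\ rule (pb2 F G);
  rule_pb_pair : forall A B X (F : functor A X) (G : functor B X)
      T (S1 : functor T A) (S2 : functor T B) (e : F \oc S1 = G \oc S2),
      rule F -> rule G -> rule S1 -> rule S2 -> rule (pb_pair e);
  rule_equalizer : forall A B (F G : functor A B),
      rule F -> rule G -> rule (eq_incl F G);
  rule_eq_induced : forall A B (F G : functor A B)
      T (S : functor T A) (e : F \oc S = G \oc S),
      rule F -> rule G -> rule S -> rule (eq_induced e);
  rule_pow_proj : forall n C (i : 'I_n),
      rule (fid C) -> rule (pow_proj C i);
  rule_pow_tuple : forall n C T (S : 'I_n -> functor T C),
      rule (fid C) -> rule (fid T) -> (forall i, rule (S i)) ->
      rule (pow_tuple S);
  sharp_closed : forall F G X H (l : functor F G) (r : functor F X)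
      (r' : functor G X) (h : functor H X) (c : cleavage h)
      (ls : nattrans (r' \oc l) r) L nu,
      rule l -> rule r -> rule r' -> policy ls -> rule h -> given K c ->
      sharp_lifting c ls L nu -> rule L /\ policy nu;
  opsharp_closed : forall F G X H (l : functor F G) (r : functor F X)
      (r' : functor G X) (h : functor H X) (c : opcleavage h)
      (ls : nattrans r (r' \oc l)) L nu,
      rule l -> rule r -> rule r' -> policy ls -> rule h -> opgiven K c ->
      opsharp_lifting c ls L nu -> rule L /\ policy nu
}.

Definition classifier (K : cleaving) (ctx : category)
  (T : judgemental_theory K ctx) (C : category) (F : functor C ctx) : Prop :=
  rule T F.

Section Generated.
Variables (K : cleaving) (ctx : category).
Variable ctx_has_terminal : exists t : ob ctx, terminal t.
Variable gR : forall C D, functor C D -> Prop.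
Variable gP : forall C D (F G : functor C D), nattrans F G -> Prop.

Definition contains (T : judgemental_theory K ctx) : Prop :=
  (forall C D (F : functor C D), gR F -> rule T F) /\
  (forall C D (F G : functor C D) (a : nattrans F G), gP a -> policy T a).

Definition generated : judgemental_theory K ctx.
Proof.
exists (fun C D (F : functor C D) => forall T, contains T -> rule T F)
       (fun C D F G (a : nattrans F G) => forall T, contains T -> policy T a).
- exact: ctx_has_terminal.
- by move=> C D F G a pa; split=> T HT; case: (policy_rule (pa T HT)).
- by move=> C D F pF; split=> T HT; case: (rule_id (pF T HT)).
- by intros; apply: rule_comp; auto.
- by intros; apply: policy_id; auto.
- by intros; apply: policy_vcomp; auto.
- by intros; apply: policy_whiskerl; auto.
- by intros; apply: policy_whiskerr; auto.
- by move=> A B X F G pF pG; split=> T HT;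
    case: (rule_pullback (pF T HT) (pG T HT)).
- by intros; apply: rule_pb_pair; auto.
- by intros; apply: rule_equalizer; auto.
- by intros; apply: rule_eq_induced; auto.
- by intros; apply: rule_pow_proj; auto.
- by intros; apply: rule_pow_tuple; auto.
- move=> F G X H l r r' h c ls L nu pl pr pr' ps ph gc sl; split=> T HT;
    by case: (sharp_closed (pl T HT) (pr T HT) (pr' T HT) (ps T HT)
                (ph T HT) gc sl).
- move=> F G X H l r r' h c ls L nu pl pr pr' ps ph gc sl; split=> T HT;
    by case: (opsharp_closed (pl T HT) (pr T HT) (pr' T HT) (ps T HT)
                (ph T HT) gc sl).
Defined.

End Generated.

(* U and Ud classify types and terms; [Sg] and [Dl] are Sigma and Delta. *)
Record plain_dtt (K : cleaving) := PlainDTT {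
  ctx : category;
  U : category;
  Ud : category;
  u : functor U ctx;
  ud : functor Ud ctx;
  u_cl : cleavage u;
  ud_cl : cleavage ud;
  Sg : functor Ud U;
  Dl : functor U Ud;
  eta : nattrans (fid Ud) (Dl \oc Sg);
  eps : nattrans (Sg \oc Dl) (fid U);
  dtt_terminal : exists t : ob ctx, terminal t;
  u_given : given K u_cl;
  ud_given : given K ud_cl;
  u_Sg : u \oc Sg = ud;
  triangle_Sg : forall a, composite (eps (Sg a)) (fmor Sg (eta a)) (idm (Sg a));
  triangle_Dl : forall A, composite (fmor Dl (eps A)) (eta (Dl A)) (idm (Dl A));
  Sg_cartesian : forall f, cartesian ud f -> cartesian u (fmor Sg f);
  Dl_cartesian : forall f, cartesian u f -> cartesian ud (fmor Dl f);
  eta_cartesian : forall a, cartesian ud (eta a);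
  eps_cartesian : forall A, cartesian u (eps A)
}.

Inductive dtt_rule K (D : plain_dtt K) : forall A B, functor A B -> Prop :=
| dtt_rule_u : dtt_rule D (u D)
| dtt_rule_ud : dtt_rule D (ud D)
| dtt_rule_Sg : dtt_rule D (Sg D)
| dtt_rule_Dl : dtt_rule D (Dl D).

Inductive dtt_policy K (D : plain_dtt K) :
  forall A B (F G : functor A B), nattrans F G -> Prop :=
| dtt_policy_eta : dtt_policy D (eta D)
| dtt_policy_eps : dtt_policy D (eps D).

Definition dtt_theory K (D : plain_dtt K) : judgemental_theory K (ctx D) :=
  generated K (dtt_terminal D) (@dtt_rule K D) (@dtt_policy K D).

Section PlainDTT.
Variables (K : cleaving) (D : plain_dtt K).

Definition ty_judgement (Gamma : ob (ctx D)) (A : ob (U D)) : Prop :=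
  u D A = Gamma.

Definition tm_judgement (Gamma : ob (ctx D)) (a : ob (Ud D)) (A : ob (U D)) :
  Prop := ud D a = Gamma /\ Sg D a = A.

(* Context extension: [ext A] is Gamma.A when A is a type in Gamma. *)
Definition ext (A : ob (U D)) : ob (ctx D) := ud D (Dl D A).

Definition eta' : nattrans (ud D \oc fid (Ud D)) (ud D \oc (Dl D \oc Sg D)) :=
  whiskerl (ud D) (eta D).

Lemma delta_src : u D \oc (Sg D \oc Dl D) = ud D \oc Dl D.
Proof. by rewrite -(u_Sg D); apply: functor_eq. Qed.

Lemma delta_tgt : u D \oc fid (U D) = u D.
Proof. exact: functor_eq. Qed.

Definition delta : nattrans (ud D \oc Dl D) (u D) :=
  nt_cast delta_src delta_tgt (whiskerl (u D) (eps D)).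

Lemma tm_judgement_ty Gamma a A : tm_judgement Gamma a A -> ty_judgement Gamma A.
Proof. by case=> <- <-; rewrite /ty_judgement -(u_Sg D). Qed.

(* In the rest of the section p : E -> ctx is u or ud, so that the objects of
   [premise] are the pairs (a, y) with y over the extended context. *)
Variables (E : category) (p : functor E (ctx D)).

Definition premise : category := pullback (ud D \oc (Dl D \oc Sg D)) p.

Definition premise_ty : category := pullback (ud D \oc Dl D) p.

Definition conclusion : category := pullback (ud D) p.

Definition premise_ty_base : functor premise_ty (ctx D) :=
  u D \oc pb1 (ud D \oc Dl D) p.

Definition conclusion_base : functor conclusion (ctx D) :=
  ud D \oc pb1 (ud D) p.

Lemma retype_comm :
  (ud D \oc Dl D) \oc (Sg D \oc pb1 (ud D \oc (Dl D \oc Sg D)) p)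
  = p \oc pb2 (ud D \oc (Dl D \oc Sg D)) p.
Proof. by apply: functor_eq => z /=; apply: (svalP z). Qed.

(* (a, y) |-> (Sigma a, y) *)
Definition retype : functor premise premise_ty := pb_pair retype_comm.

Lemma premise_compat Gamma a A y :
  tm_judgement Gamma a A -> p y = ext A ->
  (ud D \oc (Dl D \oc Sg D)) a = p y.
Proof. by case=> _ <- ->. Qed.

Lemma subst_compat Gamma a A y :
  tm_judgement Gamma a A -> p y = ext A -> tgt (eta' a) = p y.
Proof. by move=> ha hy; rewrite tgt_app; apply: premise_compat ha hy. Qed.

(* The object (a, y) of [premise]. *)
Definition premise_ob Gamma a A y
  (ha : tm_judgement Gamma a A) (hy : p y = ext A) : ob premise :=
  mkpb (premise_compat ha hy).

(* y[a] *)
Definition subst (c : cleavage p) Gamma a A y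
  (ha : tm_judgement Gamma a A) (hy : p y = ext A) : ob E :=
  reindex c (subst_compat ha hy).

(* The chosen cartesian arrow y[a] -> y. *)
Definition subst_lift (c : cleavage p) Gamma a A y
  (ha : tm_judgement Gamma a A) (hy : p y = ext A) : mor E :=
  lift c (subst_compat ha hy).

End PlainDTT.

(* Sigma sends the given lifts to the given lifts. *)
Definition Sg_cleaved K (D : plain_dtt K) : Prop :=
  forall f y (e : tgt f = ud D y) (e' : tgt f = u D (Sg D y)),
    fmor (Sg D) (lift (ud_cl D) e) = lift (u_cl D) e'.

(* Main.v *)
Require Import Defs.
From Stdlib Require Import ProofIrrelevance IndefiniteDescription.
From mathcomp Require Import all_boot.

Set Implicit Arguments.
Unset Strict Implicit.
Unset Printing Implicit Defensive.

(* A sharp lifting exists along every cloven fibration: on objects it takes the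
   domain of the chosen lift, and its action on an arrow is the unique arrow
   between chosen lifts that makes the lifts natural, so that functoriality is
   uniqueness of factorisations through cartesian arrows.  (DTy) and (DTm) are
   the cases of u and ud at the whiskered unit.  Since Sigma preserves cartesian
   arrows, Sigma(b[a]) -> B and B[a] -> B are cartesian over the same arrow, and
   so differ by a unique vertical isomorphism.  Re-basing pastes with
   u * epsilon; a theory is closed under the transports along equalities of
   functors that this pasting requires. *)

(** * Factorisation through cartesian arrows *)

Lemma composite_inj (C : category) (g f h h' : mor C) :
  composite g f h -> composite g f h' -> h = h'.
Proof. by case=> e <- [e' <-]; apply: mcomp_congr. Qed.

Lemma composite_srctgt (C : category) (g f h : mor C) :
  composite g f h -> src g = tgt f.
Proof. by case. Qed.

Lemma cartesian_inj (H X : category) (p : functor H X) f g k k' :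
  cartesian p f -> composite f k g -> composite f k' g ->
  fmor p k = fmor p k' -> k = k'.
Proof.
move=> cf ck ck' pk.
have [k0 [_ u0]] := cf _ _ (composite_tgt ck) (fmor_comp p ck).
by rewrite -(u0 k) // -(u0 k') // -pk.
Qed.

(** Each lift factors through the other over an identity. Composing the two factorisations either
    way factors a cartesian arrow through itself over an identity, so both composites are identities
    by [cartesian_inj]. *)
Lemma cartesian_lift_iso (H X : category) (p : functor H X) f y k k' :
  cartesian_lift p f y k -> cartesian_lift p f y k' ->
  exists! i, [/\ arrow i (src k') (src k), fmor p i = idm (src f),
                 isomorphism i & composite k i k'].
Proof.
have aux g g' : cartesian_lift p f y g -> cartesian_lift p f y g' ->
    exists i, fmor p i = idm (src f) /\ composite g i g'.
  move=> [pg tg cg] [pg' tg' _].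
  have [||i [[pi ci] _]] := cg g' (idm (src f)).
  - by rewrite tg tg'.
  - by rewrite pg pg'; apply: composite_id_r.
  by exists i.
have inv g g' i j : cartesian_lift p f y g ->
    fmor p i = idm (src f) -> composite g i g' ->
    fmor p j = idm (src f) -> composite g' j g ->
    composite i j (idm (tgt i)).
  move=> [pg _ cg] pi ci pj cj.
  have [m cm] : exists m, composite i j m.
    by apply: compositeE; rewrite -(composite_src ci) (composite_srctgt cj).
  have cgm : composite g m g by apply/(composite_assoc _ ci cm).
  have tm : tgt i = src g by rewrite (composite_srctgt ci).
  suff -> : idm (tgt i) = m by [].
  apply: (cartesian_inj cg _ cgm); first by rewrite tm; apply: composite_id_r.
  have := fmor_comp p cm; rewrite pi pj => pm.
  rewrite tm fmor_id -src_fmor pg; apply: composite_inj pm.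
  by rewrite -{1}(tgt_idm (src f)); apply: composite_id_l.
move=> kk kk'.
have [i [pi ci]] := aux _ _ kk kk'; have [j [pj cj]] := aux _ _ kk' kk.
exists i; split=> [|i' [_ pi' _ ci']]; last first.
  by case: kk => _ _ ck; apply: (cartesian_inj ck ci ci'); rewrite pi pi'.
split=> //.
  by rewrite /arrow (composite_src ci) (composite_srctgt ci).
exists j; split; last exact: inv kk pi ci pj cj.
rewrite -(composite_src ci) (composite_srctgt cj).
exact: inv kk' pj cj pi ci.
Qed.

Lemma pb_composite (A B X : category) (F : functor A X) (G : functor B X)
  (g f h : mor (pullback F G)) :
  composite (sval g).1 (sval f).1 (sval h).1 ->
  composite (sval g).2 (sval f).2 (sval h).2 -> composite g f h.
Proof.
move=> [e1 E1] [e2 E2].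
unshelve eexists; first by apply: sval_inj; rewrite /= e1 e2.
apply: sval_inj => /=; rewrite [RHS]surjective_pairing -E1 -E2.
by congr pair; apply: mcomp_congr.
Qed.

(** * Construction of the sharp lifting along a cloven fibration *)

Section SharpLifting.
Variables (F G X H : category) (l : functor F G).
Variables (r : functor F X) (r' : functor G X) (h : functor H X).
Variables (c : cleavage h) (ls : nattrans (r' \oc l) r).

Let lft (x : ob (pullback r h)) : mor H := Defs.lift c (sharp_compat ls x).

Lemma sharp_lift_base x : fmor h (lft x) = ls (sval x).1.
Proof. by case: (liftP c (sharp_compat ls x)). Qed.

Lemma sharp_lift_tgt x : tgt (lft x) = (sval x).2.
Proof. by case: (liftP c (sharp_compat ls x)). Qed.

Lemma sharp_lift_cart x : cartesian h (lft x).
Proof. by case: (liftP c (sharp_compat ls x)). Qed.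

Lemma sharp_lift_src x : h (src (lft x)) = r' (l (sval x).1).
Proof. by rewrite -src_fmor sharp_lift_base src_app. Qed.

(* The action of the lifting on arrows is specified as a relation, because the
   universal property of cartesian arrows only gives unique existence in Prop;
   a function is extracted by choice in [sharp_lifting_exists]. *)
Definition sharp_arrow (f : mor (pullback r h)) (k : mor H) : Prop :=
  fmor h k = fmor r' (fmor l (sval f).1) /\
  exists m, composite (lft (tgt f)) k m /\ composite (sval f).2 (lft (src f)) m.

(** Naturality of [ls] puts the lift at the source, followed by the second coordinate of [f], over
    an arrow that factors through [ls] at the target; the cartesian lift there supplies [k]. *)
Lemma sharp_arrow_exists f : exists k, sharp_arrow f k.
Proof.
have [m cm] : exists m, composite (sval f).2 (lft (src f)) m.
  by apply: compositeE; rewrite sharp_lift_tgt.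
have [||k [[pk ck] _]] :=
  sharp_lift_cart (x := tgt f) (g := m) (w := fmor r' (fmor l (sval f).1)).
- by rewrite (composite_tgt cm) sharp_lift_tgt.
(* The pullback equation of [f] rewrites the image of its second coordinate under [h] as that of the
   first under [r], where naturality of [ls] applies. *)
- have := fmor_comp h cm; rewrite !sharp_lift_base -(svalP f) => cm'.
  have [n [n1 n2]] := app_natural ls (sval f).1.
  by rewrite (composite_inj cm' n2).
by exists k; split=> //; exists m.
Qed.

Lemma sharp_arrow_src f k : sharp_arrow f k -> src k = src (lft (src f)).
Proof. by case=> _ [m [/composite_src <- /composite_src <-]]. Qed.

Lemma sharp_arrow_tgt f k : sharp_arrow f k -> tgt k = src (lft (tgt f)).
Proof. by case=> _ [m [/composite_srctgt <-]]. Qed.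

Lemma sharp_arrow_inj f k k' : sharp_arrow f k -> sharp_arrow f k' -> k = k'.
Proof.
move=> [pk [m [c1 c2]]] [pk' [m' [c1' c2']]].
have E := composite_inj c2 c2'; subst m'.
by apply: (cartesian_inj (@sharp_lift_cart _) c1 c1'); rewrite pk pk'.
Qed.

Lemma sharp_arrow_id x : sharp_arrow (idm x) (idm (src (lft x))).
Proof.
split; first by rewrite fmor_id sharp_lift_src /= !fmor_id.
exists (lft x); rewrite tgt_idm src_idm; split; first exact: composite_id_r.
by rewrite /= -sharp_lift_tgt; apply: composite_id_l.
Qed.

(** Pasting the squares of [k] and [k'] gives a square for [gf], and such a filler is unique. *)
Lemma sharp_arrow_comp g f gf k k' k2 : composite g f gf ->
  sharp_arrow g k -> sharp_arrow f k' -> sharp_arrow gf k2 ->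
  composite k k' k2.
Proof.
move=> cgf ak ak' ak2; have e := composite_srctgt cgf.
have [n cn] : exists n, composite k k' n.
  by apply: compositeE; rewrite (sharp_arrow_src ak) (sharp_arrow_tgt ak') e.
suff /(sharp_arrow_inj ak2) -> : sharp_arrow gf n by [].
case: ak ak' => pk [m [c1 c2]] [pk' [m' [c1' c2']]]; split.
  apply: (composite_inj (fmor_comp h cn)); rewrite pk pk'.
  exact/fmor_comp/fmor_comp/(fmor_comp (pb1 r h) cgf).
rewrite (composite_tgt cgf) (composite_src cgf).
have [q cq] : exists q, composite (sval g).2 m' q.
  by apply: compositeE; rewrite (composite_tgt c1') sharp_lift_tgt -e.
exists q; split.
  apply/(composite_assoc _ c1 cn).
  apply/(composite_assoc _ _ c1'); last exact: cq.
  by rewrite -e.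
by apply/(composite_assoc _ (fmor_comp (pb2 r h) cgf) c2').
Qed.

Lemma sharp_lifting_exists : exists L nu, sharp_lifting c ls L nu.
Proof.
have [K aK] := functional_choice _ sharp_arrow_exists.
pose L0 x : ob (pullback r' h) := mkpb (esym (sharp_lift_src x)).
have L1P f : fmor r' (fmor l (sval f).1) = fmor h (K f) by case: (aK f).
pose L1 f : mor (pullback r' h) :=
  exist (fun f => fmor r' f.1 = fmor h f.2) (fmor l (sval f).1, K f) (L1P f).
unshelve eexists.
  exists L0 L1 => [f|f|x|g f gf cgf].
  - by apply: sval_inj; rewrite /= src_fmor (sharp_arrow_src (aK f)).
  - by apply: sval_inj; rewrite /= tgt_fmor (sharp_arrow_tgt (aK f)).
  - apply: sval_inj; rewrite /= fmor_id.
    by rewrite (sharp_arrow_inj (aK _) (sharp_arrow_id x)).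
  - apply: pb_composite; first exact/fmor_comp/(fmor_comp (pb1 r h) cgf).
    exact: sharp_arrow_comp cgf (aK _) (aK _) (aK _).
unshelve eexists.
  (* Naturality of the lifts is the square recorded in [sharp_arrow]. *)
  exists lft => [x|x|f] //; first exact: sharp_lift_tgt.
  by case: (aK f).
by split=> //; apply: functor_eq.
Qed.

End SharpLifting.

(** * Transport along equalities of functors *)

Lemma nt_castE (C D : category) (F F' G G' : functor C D)
  (eF : F = F') (eG : G = G') (a : nattrans F G) x : nt_cast eF eG a x = a x.
Proof. by case: _ / eF; case: _ / eG. Qed.

Lemma policy_nt_cast K X (T : judgemental_theory K X) (C D : category)
  (F F' G G' : functor C D) (eF : F = F') (eG : G = G') (a : nattrans F G) :
  policy T a -> policy T (nt_cast eF eG a).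
Proof. by case: _ / eF; case: _ / eG. Qed.

(** * Membership of the lifted rules and policies in the generated theory *)

Section Membership.
Variables (K : cleaving) (D : plain_dtt K).
Let T := dtt_theory D.

Lemma dtt_theory_rule A B (F : functor A B) : dtt_rule D F -> rule T F.
Proof. by move=> RF T' [+ _]; apply. Qed.

Lemma dtt_theory_policy A B (F G : functor A B) (a : nattrans F G) :
  dtt_policy D a -> policy T a.
Proof. by move=> Pa T' [_]; apply. Qed.

Let rule_u : rule T (u D). Proof. exact/dtt_theory_rule/dtt_rule_u. Qed.
Let rule_ud : rule T (ud D). Proof. exact/dtt_theory_rule/dtt_rule_ud. Qed.
Let rule_Sg : rule T (Sg D). Proof. exact/dtt_theory_rule/dtt_rule_Sg. Qed.
Let rule_Dl : rule T (Dl D). Proof. exact/dtt_theory_rule/dtt_rule_Dl. Qed.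

Lemma policy_eta' : policy T (eta' D).
Proof. exact/policy_whiskerl/dtt_theory_policy/dtt_policy_eta. Qed.

Lemma policy_delta : policy T (delta D).
Proof.
exact/policy_nt_cast/policy_whiskerl/dtt_theory_policy/dtt_policy_eps.
Qed.

Let rule_ext : rule T (ud D \oc (Dl D \oc Sg D)).
Proof. by do !apply: rule_comp. Qed.

Variables (E : category) (p : functor E (ctx D)) (c : cleavage p).
Hypotheses (rule_p : rule T p) (given_c : given K c).
Variables (L : functor (premise p) (conclusion p)).
Variable nu : nattrans (pb2 (ud D) p \oc L) (pb2 (ud D \oc (Dl D \oc Sg D)) p).
Hypothesis sL : sharp_lifting c (eta' D) L nu.

(** The source of [eta'] is literally [ud D \oc fid (Ud D)], so closure under sharp liftings applies
    with the identity of [Ud D] as [l]. *)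
Lemma eta'_sharp_closed : rule T L /\ policy T nu.
Proof.
by apply: (sharp_closed _ _ _ policy_eta' _ given_c sL) => //;
  case: (rule_id rule_ud).
Qed.

Lemma rule_retype : rule T (retype p).
Proof.
have [r1 r2] := rule_pullback rule_ext rule_p.
by apply: rule_pb_pair => //; apply: rule_comp.
Qed.

Lemma rule_premise_ty_base : rule T (premise_ty_base p).
Proof.
apply: rule_comp => //.
by case: (rule_pullback (rule_comp rule_ud rule_Dl) rule_p).
Qed.

Lemma rule_conclusion_base : rule T (conclusion_base p).
Proof. by apply: rule_comp => //; case: (rule_pullback rule_ud rule_p). Qed.

(** * Re-basing the premise over Gamma *)

Lemma rebase_src :
  p \oc (pb2 (ud D) p \oc L) = conclusion_base p \oc L.
Proof. by apply: functor_eq => x /=; [case: (L x) | case: (fmor L x)]. Qed.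

Lemma rebase_mid :
  p \oc pb2 (ud D \oc (Dl D \oc Sg D)) p
  = (ud D \oc Dl D) \oc (pb1 (ud D \oc Dl D) p \oc retype p).
Proof. by apply: functor_eq => -[x /= ->]. Qed.

Lemma rebase_tgt :
  u D \oc (pb1 (ud D \oc Dl D) p \oc retype p)
  = premise_ty_base p \oc retype p.
Proof. exact: functor_eq. Qed.

(** When [nu] comes from the sharp lifting, the component at (a, y) is Gamma -> Gamma.A -> Gamma,
    that is [eta'] at a followed by [delta] at Sigma a. The inner cast uses the defining equations
    of the two pullbacks to make [nu] and [delta] composable. *)
Definition rebase :
  nattrans (conclusion_base p \oc L) (premise_ty_base p \oc retype p) :=
  nt_cast erefl rebase_tgt
    (vcomp (whiskerr (delta D) (pb1 (ud D \oc Dl D) p \oc retype p))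
           (nt_cast rebase_src rebase_mid (whiskerl p nu))).

Lemma policy_rebase : policy T rebase.
Proof.
apply/policy_nt_cast/policy_vcomp.
  apply: policy_whiskerr policy_delta _; apply: rule_comp rule_retype.
  by case: (rule_pullback (rule_comp rule_ud rule_Dl) rule_p).
by apply/policy_nt_cast/policy_whiskerl => //; case: eta'_sharp_closed.
Qed.

Lemma rebase_composite x :
  composite (delta D (pb1 _ _ (retype p x))) (fmor p (nu x)) (rebase x).
Proof.
rewrite /rebase nt_castE /=.
(* The compatibility proof is generalised because its type mentions the cast component being
   rewritten. *)
set e := vcomp_compat _ _ _; move: e; rewrite nt_castE /= => e.
by exists e.
Qed.

(** * Substitution in terms of judgements *)

Variables (Gamma : ob (ctx D)) (A : ob (U D)) (a : ob (Ud D)) (y : ob E).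
Hypotheses (ha : tm_judgement Gamma a A) (hy : p y = ext A).

Lemma eta'_arrow : arrow (eta' D a) Gamma (ext A).
Proof. by case: ha => <- <-; split; rewrite ?src_app ?tgt_app. Qed.

Lemma subst_base : p (subst c ha hy) = Gamma.
Proof.
rewrite /subst /reindex -src_fmor; case: (liftP c (subst_compat ha hy)) => -> _ _.
by case: eta'_arrow.
Qed.

(** The chosen lift takes a compatibility proof as argument; the two proofs in play agree by proof
    irrelevance. *)
Lemma sharp_lifting_app : nu (premise_ob ha hy) = subst_lift c ha hy.
Proof. by case: sL => _ ->; congr Defs.lift; apply: proof_irrelevance. Qed.

(** The first coordinate is fixed because [L] lies over the identity; the second is the source of
    the component of [nu], a chosen lift. *)
Lemma sharp_lifting_ob : sval (L (premise_ob ha hy)) = (a, subst c ha hy).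
Proof.
case: (sL) => eL _; rewrite [LHS]surjective_pairing; congr pair.
  exact: (congr1 (fun F : functor _ _ => F (premise_ob ha hy)) eL).
by have := src_app nu (premise_ob ha hy); rewrite sharp_lifting_app => /esym.
Qed.

Lemma subst_liftP : cartesian_lift p (eta' D a) y (subst_lift c ha hy).
Proof. exact: liftP. Qed.

Lemma subst_lift_arrow : arrow (subst_lift c ha hy) (subst c ha hy) y.
Proof. by split=> //; case: subst_liftP. Qed.

Lemma rebase_arrow : arrow (rebase (premise_ob ha hy)) Gamma Gamma.
Proof.
split; rewrite ?src_app ?tgt_app /=.
  by rewrite sharp_lifting_ob; case: ha.
case: ha => <- _.
(* The target is u(Sigma a), which is Gamma because u Sigma equals the projection of terms. *)
exact: (congr1 (fun F : functor _ _ => F a) (u_Sg D)).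
Qed.

Lemma retype_ob : sval (retype p (premise_ob ha hy)) = (A, y).
Proof. by rewrite /=; case: ha => _ ->. Qed.

End Membership.

(** * Typing of substituted terms and assembly of the rules *)

Lemma Sg_cartesian_lift K (D : plain_dtt K) f b k :
  cartesian_lift (ud D) f b k ->
  cartesian_lift (u D) f (Sg D b) (fmor (Sg D) k).
Proof.
case=> pk tk ck; split; last exact: Sg_cartesian.
  by rewrite -pk -(u_Sg D).
by rewrite tgt_fmor tk.
Qed.

Theorem mainTheorem7 (K : cleaving) (D : plain_dtt K) :
  exists (LT : functor (premise (u D)) (conclusion (u D)))
         (nT : nattrans (pb2 (ud D) (u D) \oc LT)
                        (pb2 (ud D \oc (Dl D \oc Sg D)) (u D)))
         (Lt : functor (premise (ud D)) (conclusion (ud D)))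
         (nt : nattrans (pb2 (ud D) (ud D) \oc Lt)
                        (pb2 (ud D \oc (Dl D \oc Sg D)) (ud D))),
  (* the sharp liftings of eta' along u and ud, and their membership *)
  (sharp_lifting (u_cl D) (eta' D) LT nT /\
   sharp_lifting (ud_cl D) (eta' D) Lt nt /\
   rule (dtt_theory D) LT /\ policy (dtt_theory D) nT /\
   rule (dtt_theory D) Lt /\ policy (dtt_theory D) nt) /\
  (* (DTy) *)
  (forall (Gamma : ob (ctx D)) (A : ob (U D)) (a : ob (Ud D)) (B : ob (U D))
          (ha : tm_judgement Gamma a A) (hB : ty_judgement (ext A) B),
     sval (LT (premise_ob ha hB)) = (a, subst (u_cl D) ha hB) /\
     ty_judgement Gamma (subst (u_cl D) ha hB) /\
     arrow (eta' D a) Gamma (ext A) /\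
     nT (premise_ob ha hB) = subst_lift (u_cl D) ha hB /\
     arrow (nT (premise_ob ha hB)) (subst (u_cl D) ha hB) B /\
     cartesian_lift (u D) (eta' D a) B (nT (premise_ob ha hB))) /\
  (* (DTm) *)
  (forall (Gamma : ob (ctx D)) (A : ob (U D)) (a b : ob (Ud D)) (B : ob (U D))
          (ha : tm_judgement Gamma a A) (hb : tm_judgement (ext A) b B),
     sval (Lt (premise_ob ha (proj1 hb)))
       = (a, subst (ud_cl D) ha (proj1 hb)) /\
     ud D (subst (ud_cl D) ha (proj1 hb)) = Gamma /\
     nt (premise_ob ha (proj1 hb)) = subst_lift (ud_cl D) ha (proj1 hb) /\
     arrow (nt (premise_ob ha (proj1 hb)))
       (subst (ud_cl D) ha (proj1 hb)) b /\
     cartesian_lift (ud D) (eta' D a) b (nt (premise_ob ha (proj1 hb))) /\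
     (* typing: Sigma (b[a]) is B[a], up to the canonical vertical isomorphism
        for arbitrary cleavages, on the nose when Sigma preserves them *)
     cartesian_lift (u D) (eta' D a) B
       (fmor (Sg D) (nt (premise_ob ha (proj1 hb)))) /\
     (exists! i : mor (U D),
        [/\ arrow i (Sg D (subst (ud_cl D) ha (proj1 hb)))
                    (subst (u_cl D) ha (tm_judgement_ty hb)),
            fmor (u D) i = idm Gamma,
            isomorphism i &
            composite (subst_lift (u_cl D) ha (tm_judgement_ty hb)) i
              (fmor (Sg D) (nt (premise_ob ha (proj1 hb))))]) /\
     (Sg_cleaved D ->
        tm_judgement Gamma (subst (ud_cl D) ha (proj1 hb))
          (subst (u_cl D) ha (tm_judgement_ty hb)))) /\
  (* re-basing of the premises over Gamma *)
  policy (dtt_theory D) (delta D) /\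
  (rule (dtt_theory D) (retype (u D)) /\
   classifier (dtt_theory D) (premise_ty_base (u D)) /\
   classifier (dtt_theory D) (conclusion_base (u D)) /\
   exists theta : nattrans (conclusion_base (u D) \oc LT)
                           (premise_ty_base (u D) \oc retype (u D)),
     policy (dtt_theory D) theta /\
     (forall x, composite (delta D (pb1 _ _ (retype (u D) x)))
                          (fmor (u D) (nT x)) (theta x)) /\
     (forall (Gamma : ob (ctx D)) (A : ob (U D)) (a : ob (Ud D)) (B : ob (U D))
             (ha : tm_judgement Gamma a A) (hB : ty_judgement (ext A) B),
        sval (retype (u D) (premise_ob ha hB)) = (A, B) /\
        arrow (theta (premise_ob ha hB)) Gamma Gamma)) /\
  (rule (dtt_theory D) (retype (ud D)) /\
   classifier (dtt_theory D) (premise_ty_base (ud D)) /\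
   classifier (dtt_theory D) (conclusion_base (ud D)) /\
   exists theta : nattrans (conclusion_base (ud D) \oc Lt)
                           (premise_ty_base (ud D) \oc retype (ud D)),
     policy (dtt_theory D) theta /\
     (forall x, composite (delta D (pb1 _ _ (retype (ud D) x)))
                          (fmor (ud D) (nt x)) (theta x)) /\
     (forall (Gamma : ob (ctx D)) (A : ob (U D)) (a b : ob (Ud D))
             (B : ob (U D))
             (ha : tm_judgement Gamma a A) (hb : tm_judgement (ext A) b B),
        sval (retype (ud D) (premise_ob ha (proj1 hb))) = (A, b) /\
        arrow (theta (premise_ob ha (proj1 hb))) Gamma Gamma)).
Proof.
have [LT [nT sT]] := sharp_lifting_exists (u_cl D) (eta' D).
have [Lt [nt st]] := sharp_lifting_exists (ud_cl D) (eta' D).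
have ru : rule (dtt_theory D) (u D) by apply/dtt_theory_rule/dtt_rule_u.
have rud : rule (dtt_theory D) (ud D) by apply/dtt_theory_rule/dtt_rule_ud.
have [rT pT] := eta'_sharp_closed ru (u_given D) sT.
have [rt pt] := eta'_sharp_closed rud (ud_given D) st.
exists LT, nT, Lt, nt; split; first by [].
split.
  move=> Gamma A a B ha hB; rewrite (sharp_lifting_app sT).
  split; first exact: (sharp_lifting_ob sT).
  split; first exact: subst_base.
  split; first exact: eta'_arrow ha.
  by split=> //; split; [apply: subst_lift_arrow | apply: subst_liftP].
split.
  move=> Gamma A a b B ha hb; rewrite (sharp_lifting_app st).
  split; first exact: (sharp_lifting_ob st).
  split; first exact: subst_base.
  split; first by [].
  split; first exact: subst_lift_arrow.
  split; first exact: subst_liftP.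
  have cS : cartesian_lift (u D) (eta' D a) B
      (fmor (Sg D) (subst_lift (ud_cl D) ha (proj1 hb))).
    (* The proof inside the lift is abstracted first, so that B can be replaced by Sigma b. *)
    by move: (proj1 hb) => hb1; case: hb => _ <-; apply/Sg_cartesian_lift/subst_liftP.
  split; first exact: cS.
  split.
    have := cartesian_lift_iso
      (subst_liftP (u_cl D) ha (tm_judgement_ty hb)) cS.
    by rewrite src_fmor (proj1 (eta'_arrow ha)).
  move=> cl; split; first exact: subst_base.
  (* Sigma(b[a]) is the domain of the image of the chosen lift at b; [cl] makes that image the
     chosen lift at Sigma b, whose domain is B[a]. *)
  rewrite /subst /reindex -src_fmor.
  case: hb {cS} => hb1 hb2 /=; subst B.
  by rewrite (cl _ _ _ (subst_compat ha (tm_judgement_ty (conj hb1 erefl)))).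
split; first exact: policy_delta.
split.
  split; first exact: rule_retype.
  split; first exact: rule_premise_ty_base.
  split; first exact: rule_conclusion_base.
  exists (rebase nT); split; first exact: (policy_rebase ru (u_given D) sT).
  split=> [x|Gamma A a B ha hB]; first exact: rebase_composite.
  by split; [apply: retype_ob | apply: (rebase_arrow sT)].
split; first exact: rule_retype.
split; first exact: rule_premise_ty_base.
split; first exact: rule_conclusion_base.
exists (rebase nt); split; first exact: (policy_rebase rud (ud_given D) st).
split=> [x|Gamma A a b B ha hb]; first exact: rebase_composite.
by split; [apply: retype_ob | apply: (rebase_arrow st)].
Qed.
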